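(* For every positive integer $x$ and every nonnegative integer $n$, \[ sf^{(n)}(x)=\prod_{k=1}^{x}\bigl[(x-k)+1\bigr]^{P_n(k)}=\prod_{k=1}^{x}k^{P_n((x-k)+1)}. \]
   Context: For integers $r\ge 0$ and $m\ge 1$, the $r$-simplex (figurate) number is $P_r(m)=\binom{m+r-1}{r}$ (so $P_0(m)=1$). The generalized ($n$th-degree) superfactorial is defined recursively for positive integers $x$ by $sf^{(0)}(x)=x!$ and, for $n\ge 1$, $sf^{(n)}(x)=\prod_{k=1}^{x} sf^{(n-1)}(k)$. (Thus $sf^{(1)}(x)=\prod_{k=1}^x k!$ is the usual superfactorial.) *)

(* Defs.v *)
From mathcomp Require Import all_boot.

Set Implicit Arguments.
Unset Strict Implicit.
Unset Printing Implicit Defensive.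

(* Intended for 0 < m, where the truncated subtraction is exact. *)
Definition simplex_number (r m : nat) : nat := 'C(m + r - 1, r).

(* Intended for 0 < x; the value at x = 0 is the empty product 1. *)
Fixpoint superfactorial (n x : nat) : nat :=
  if n is n'.+1 then \prod_(1 <= k < x.+1) superfactorial n' k else x`!.

(* Main.v *)
(* By Pascal's rule the exponents satisfy P_{n+1}(m+1) = P_{n+1}(m) + P_n(m+1),
   which is exactly the recursion sf^{(n+1)}(x+1) = sf^{(n+1)}(x) * sf^{(n)}(x+1)
   read on the exponent of each k; the two products are reversals of each
   other. *)
Require Import Defs.
From mathcomp Require Import all_boot.

(* At m = 0 this relies on the junk value P_{n+1}(0) = 'C(n, n.+1) = 0. *)
Lemma simplex_numberSS n m :
  simplex_number n.+1 m.+1 = simplex_number n.+1 m + simplex_number n m.+1.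
Proof. by rewrite /simplex_number addSn !addnS !subn1 binS. Qed.

Lemma superfactorialSS n x :
  superfactorial n.+1 x.+1 = superfactorial n.+1 x * superfactorial n x.+1.
Proof. by rewrite /= big_nat_recr. Qed.

(** With [x.+1 - k] instead of [(x - k) + 1], the argument is 0 at [k = x.+1], as the induction
    needs; both agree for [k <= x]. *)
Lemma superfactorialE n x :
  superfactorial n x = \prod_(1 <= k < x.+1) k ^ simplex_number n (x.+1 - k).
Proof.
elim: n x => [|n IHn] x.
  rewrite [LHS]fact_prod; apply: eq_bigr => k _.
  by rewrite /simplex_number bin0 expn1.
elim: x => [|x IHx]; first by rewrite /= !big_geq.
rewrite superfactorialSS IHx IHn.
(* The added factor at [k = x.+1] is 1, its exponent being ['C(n, n.+1) = 0]; both products then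
   share one range. *)
have -> : \prod_(1 <= k < x.+1) k ^ simplex_number n.+1 (x.+1 - k)
        = \prod_(1 <= k < x.+2) k ^ simplex_number n.+1 (x.+1 - k).
  rewrite [RHS]big_nat_recr //= subnn.
  by rewrite [simplex_number _ 0]bin_small ?addSn ?subn1 // expn0 muln1.
rewrite -big_split; apply: eq_big_nat => k /andP[_ le_kx] /=.
by rewrite (@subSn k x.+1) ?simplex_numberSS ?expnD.
Qed.

Theorem theorem3p2 (x n : nat) (hx : 0 < x) :
  superfactorial n x
    = \prod_(1 <= k < x.+1) ((x - k) + 1) ^ simplex_number n k
  /\ \prod_(1 <= k < x.+1) ((x - k) + 1) ^ simplex_number n k
    = \prod_(1 <= k < x.+1) k ^ simplex_number n ((x - k) + 1).
Proof.
have prod_rev : \prod_(1 <= k < x.+1) ((x - k) + 1) ^ simplex_number n k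
    = \prod_(1 <= k < x.+1) k ^ simplex_number n ((x - k) + 1).
  (* Reversal replaces [k] by [x.+1 - k]; [0 < k <= x] keeps the truncated subtractions exact. *)
  rewrite big_nat_rev; apply: eq_big_nat => k /andP[k_gt0 le_kx].
  have le_rev : x.+1 - k <= x by rewrite leq_subLR -add1n leq_add2r.
  by rewrite add1n subSS !addn1 -(subSn le_rev) -subSn // subKn // ltnW.
split=> //; rewrite prod_rev superfactorialE.
by apply: eq_big_nat => k /andP[_ le_kx]; rewrite addn1 -subSn.
Qed.
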